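(* Let $\mathcal{F}$ be a filter on $\omega$ that contains every cofinite subset of $\omega$ and is not equal to the Fréchet filter $\{A\subset\omega:\omega\setminus A\text{ is finite}\}$. Then $\mathcal{F}$, as a subspace of $\mathcal{P}(\omega)$, is not $\mathrm{S}_1(\Gamma,\mathcal{O})$. In particular, $\mathcal{F}$ satisfies none of the six properties $\mathrm{S}_1(\Gamma,\Gamma)$, $\mathrm{S}_1(\Gamma,\Omega)$, $\mathrm{S}_1(\Gamma,\mathcal{O})$, $\mathrm{S}_1(\Omega,\Gamma)$, $\mathrm{S}_1(\Omega,\Omega)$, $\mathrm{S}_1(\mathcal{O},\mathcal{O})$.
   Context: A filter on $\omega$ is a family $\mathcal{F}\subset\mathcal{P}(\omega)$ with $\emptyset\notin\mathcal{F}$, closed under intersections of two elements and under supersets in $\omega$. $\mathcal{P}(\omega)$ carries the Cantor set topology obtained by identifying it with ${}^{\omega}2$ via characteristic functions, and $\mathcal{F}$ has the subspace topology. For a (Lindelöf) topological space $X$: $\mathcal{O}$ is the collection of open covers of $X$. $\Omega$ is the collection of $\omega$-covers, i.e. open covers $\mathcal{U}$ such that $X\notin\mathcal{U}$ and for every finite $S\subset X$ there is $U\in\mathcal{U}$ with $S\subset U$. $\Gamma$ is the collection of $\gamma$-covers, i.e. open covers $\mathcal{U}$ that are infinite and such that for every $x\in X$ the set $\{U\in\mathcal{U}:x\notin U\}$ is finite. For families $\mathcal{A},\mathcal{B}$ of open covers of $X$, the space $X$ is $\mathrm{S}_1(\mathcal{A},\mathcal{B})$ if for every sequence $(\mathcal{U}_n)_{n<\omega}$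 of elements of $\mathcal{A}$ one can choose $U_n\in\mathcal{U}_n$ for each $n<\omega$ such that $\{U_n:n<\omega\}\in\mathcal{B}$. *)

(* Defs.v *)
From HB Require Import structures.
From mathcomp Require Import all_boot all_order all_algebra.
From mathcomp Require Import all_classical all_reals all_analysis.
Set Implicit Arguments.
Unset Strict Implicit.
Unset Printing Implicit Defensive.

Local Open Scope classical_set_scope.

Definition char_fun (A : set nat) : cantor_space := fun n => n \in A.

(* P(omega) with the topology making [char_fun] a homeomorphism onto 2^omega;
   its carrier is convertible to [set nat]. *)
Definition powerset_omega : topologicalType := initial_topology char_fun.

(* A subset of P(omega) as a space in its own right: [set_type] carries the
   subspace topology. *)
Definition subspace_powerset (F : set (set nat)) : topologicalType :=
  set_type (F : set powerset_omega).

Definition frechet : set (set nat) := [set A | finite_set (~` A)].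

Section Covers.
Variable X : topologicalType.
Implicit Type U : set (set X).

Definition open_covers : set (set (set X)) :=
  [set U | (forall V, U V -> open V) /\ \bigcup_(V in U) V = setT].

Definition omega_covers : set (set (set X)) :=
  [set U | [/\ open_covers U, ~ U setT &
    forall S : set X, finite_set S -> exists2 V, U V & S `<=` V]].

(* The whole space is allowed to be a member of a gamma-cover. *)
Definition gamma_covers : set (set (set X)) :=
  [set U | [/\ open_covers U, infinite_set U &
    forall x : X, finite_set [set V | U V /\ ~ V x]]].

(* The selected family is the set [range V]: repetitions are not counted. *)
Definition S1 (A B : set (set (set X))) : Prop :=
  forall U : nat -> set (set X), (forall n, A (U n)) ->
  exists V : nat -> set X, (forall n, U n (V n)) /\ B (range V).

End Covers.

Arguments open_covers X : clear implicits.
Arguments omega_covers X : clear implicits.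
Arguments gamma_covers X : clear implicits.
Arguments S1 X A B : clear implicits.

(* Main.v *)
Require Import Defs.
From mathcomp Require Import all_boot all_order all_algebra.
From mathcomp Require Import all_classical all_reals all_analysis.

Local Open Scope classical_set_scope.

(** The idea is that a set [A] of the filter with infinite complement puts a
    whole Cantor set, [{C | A `<=` C}], inside the filter, and that the Cantor
    set fails S_1(Gamma, O) because it is an infinite power of itself.

    Index infinitely many elements of the complement of [A] injectively as
    [b (n, k)], a matrix whose rows are disjoint infinite blocks.  Let
    [row_marks b n k] consist of the [C] in the filter that meet the [n]-th row
    exactly in its [k]-th entry.  For a fixed [n] these sets are closed,
    nonempty and pairwise disjoint, so each point is missed by at most one of
    their complements: the complements form a gamma-cover
    ([row_cover_gamma]), and, as the whole space is not among them, also an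
    omega-cover ([row_cover_omega]).  A selection from these covers amounts to a
    choice of one entry [k n] in each row, and adding the chosen entries to [A]
    gives a member of the filter that lies outside every selected set
    ([row_cover_selection]).  Since the six properties weaken to a selection of
    an open cover from covers that are both gamma and omega, all of them
    fail. *)

(** Only finitely many members of a gamma-cover miss some point of a given finite
    set; as the cover is infinite, another member contains the finite set. *)
Lemma gamma_omega_covers (X : topologicalType) (U : set (set X)) :
  gamma_covers X U -> ~ U setT -> omega_covers X U.
Proof.
move=> [Uopen Uinf Ufin] UT; split=> // S Sfin; apply: contrapT => noV.
apply: Uinf; apply: (@sub_finite_set _ _
  (\bigcup_(x in S) [set V | U V /\ ~ V x])); last first.
  by apply: bigcup_finite => // x _; exact: Ufin.
move=> V UV; apply: contrapT => VS; apply: noV; exists V => // x Sx.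
by apply: contrapT => Vx; apply: VS; exists x.
Qed.

Lemma sub_S1 (X : topologicalType) (A A' B B' : set (set (set X))) :
  A' `<=` A -> B `<=` B' -> S1 X A B -> S1 X A' B'.
Proof.
move=> AA BB S1AB U A'U.
have [V [UV BV]] := S1AB U (fun n => AA _ (A'U n)).
by exists V; split => //; exact: BB.
Qed.

Section RowCovers.
Variables (F : set_system nat) (b : nat * nat -> nat).
Local Notation X := (subspace_powerset F).

(** Typed as a set of numbers, where [set_val] would give a point of the space
    [powerset_omega]. *)
Definition carrier (C : X) : set nat := set_val C.

Definition row_marks (n k : nat) : set X :=
  [set C | forall j, carrier C (b (n, j)) <-> j = k].

Definition row_cover (n : nat) : set (set X) :=
  range (fun k => ~` row_marks n k).

Lemma open_membership (m : nat) (P : set bool) :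
  open [set C : X | P (m \in carrier C)].
Proof.
have cont : continuous ((fun x : cantor_space => x m) \o char_fun \o
    (set_val : X -> powerset_omega)).
  move=> C; apply: continuous_comp; first exact: initial_continuous.
  apply: continuous_comp; first exact: initial_continuous.
  exact: (@proj_continuous _ (fun _ => bool) m).
have oP : open (P : set bool) by exact: discrete_open.
by move/continuousP: cont => /(_ P oP).
Qed.

Lemma row_marks_compl_open n k : open (~` row_marks n k).
Proof.
have -> : ~` row_marks n k = \bigcup_j
    [set C : X | [set c : bool | ~ (c <-> j = k)] (b (n, j) \in carrier C)].
  apply/seteqP; split=> C /=.
    move=> /existsNP [j Cj]; exists j => //= e; apply: Cj.
    by rewrite -e; split=> [/mem_set|/set_mem].
  move=> [j _ /= Cj] e; apply: Cj; rewrite -e.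
  by split=> [/set_mem|/mem_set].
by apply: bigcup_open => j _; exact: open_membership.
Qed.

Lemma row_marks_inj {n k l : nat} {C : X} :
  row_marks n k C -> row_marks n l C -> k = l.
Proof. by move=> Ck Cl; apply/(Cl k)/(Ck k). Qed.

Hypothesis F_filter : Filter F.
Variable A : set nat.
Hypothesis FA : F A.
Hypothesis b_inj : injective b.
Hypothesis b_A : forall p, ~ A (b p).

(** Every choice of one entry per row is realised by a point of the filter:
    the rows are disjoint from each other and from [A]. *)
Lemma row_marks_choice (k : nat -> nat) :
  exists C : X, forall n, row_marks n (k n) C.
Proof.
pose C0 := A `|` range (fun n => b (n, k n)).
have FC0 : F C0 by apply: filterS FA => x Ax; left.
exists (exist _ C0 (mem_set FC0)) => n j; split=> /=.
  by case=> [/b_A//|[m _ /b_inj [<- <-]]].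
by move=> ->; right; exists n.
Qed.

Lemma row_marks_neq0 n k : row_marks n k !=set0.
Proof. by have [C Ck] := row_marks_choice (fun=> k); exists C. Qed.

(** A point outside two members of the cover would mark its row twice; the same
    disjointness, with nonemptiness, makes the cover infinite. *)
Lemma row_cover_gamma n : gamma_covers X (row_cover n).
Proof.
split; first split.
- by move=> _ [k _ <-]; exact: row_marks_compl_open.
- apply/seteqP; split=> // C _.
  have [C0|C0] := pselect (row_marks n 0 C).
    exists (~` row_marks n 1); first by exists 1.
    by move=> C1; have := row_marks_inj C0 C1.
  by exists (~` row_marks n 0) => //; exists 0.
- have inj : {in setT &, injective (fun k => ~` row_marks n k)}.
    move=> k l _ _ /setC_inj kl; have [C Ck] := row_marks_neq0 n k.
    by apply: (row_marks_inj Ck); rewrite -kl.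
  by apply/infiniteP; move: (inj_card_eq inj); rewrite card_eq_le => /andP[].
- move=> C; have [[k Ck]|Cn] := pselect (exists k, row_marks n k C).
    apply: (@sub_finite_set _ _ [set ~` row_marks n k]) => //.
    by move=> _ [[l _ <-] /contrapT Cl]; rewrite (row_marks_inj Cl Ck).
  apply: (@sub_finite_set _ _ set0) => //.
  by move=> _ [[l _ <-] /contrapT Cl]; apply: Cn; exists l.
Qed.

Lemma row_cover_omega n : omega_covers X (row_cover n).
Proof.
apply: gamma_omega_covers; first exact: row_cover_gamma.
move=> [k _ kT]; have [C Ck] := row_marks_neq0 n k.
by have : setT C by []; rewrite -kT; apply.
Qed.

Lemma row_cover_selection (V : nat -> set X) :
  (forall n, row_cover n (V n)) -> ~ open_covers X (range V).
Proof.
move=> UV [_ VT].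
have /choice [k kV] : forall n, exists k, ~` row_marks n k = V n.
  by move=> n; have [k _ <-] := UV n; exists k.
have [C Ck] := row_marks_choice k.
have : setT C by [].
by rewrite -VT => -[_ [n _ <-]]; rewrite -kV; apply.
Qed.

Lemma not_S1_gamma_omega_open :
  ~ S1 X (gamma_covers X `&` omega_covers X) (open_covers X).
Proof.
move=> /(_ row_cover) [n|V [/row_cover_selection]//].
by split; [exact: row_cover_gamma|exact: row_cover_omega].
Qed.

End RowCovers.

Lemma infinite_matrix (B : set nat) : infinite_set B ->
  exists2 b : nat * nat -> nat, injective b & forall p, B (b p).
Proof.
move=> /infiniteP/ppcard_leP [f].
exists (f \o pickle) => [p q /= fpq|p]; last exact: funS.
by apply: (pcan_inj pickleK); apply: (inj (f := f)) fpq; exact: mem_set.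
Qed.

Theorem mainTheorem1 (F : set_system nat) (F_filter : ProperFilter F)
    (F_cofinite : frechet `<=` F) (F_neq : F <> frechet) :
  let X := subspace_powerset F in
  ~ S1 X (gamma_covers X) (open_covers X) /\
  (~ S1 X (gamma_covers X) (gamma_covers X) /\
   ~ S1 X (gamma_covers X) (omega_covers X) /\
   ~ S1 X (gamma_covers X) (open_covers X) /\
   ~ S1 X (omega_covers X) (gamma_covers X) /\
   ~ S1 X (omega_covers X) (omega_covers X) /\
   ~ S1 X (open_covers X) (open_covers X)).
Proof.
move=> X.
have [A FA Ainf] : exists2 A, F A & infinite_set (~` A).
  apply: contrapT => noA; apply: F_neq; apply/seteqP; split=> // A FA.
  by apply: contrapT => Ainf; apply: noA; exists A.
have [b b_inj b_A] := infinite_matrix _ Ainf.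
have nS1 := not_S1_gamma_omega_open F b _ _ FA b_inj b_A.
have GO : gamma_covers X `<=` open_covers X by move=> U [].
have WO : omega_covers X `<=` open_covers X by move=> U [].
have IG : gamma_covers X `&` omega_covers X `<=` gamma_covers X by move=> U [].
have IW : gamma_covers X `&` omega_covers X `<=` omega_covers X by move=> U [].
have IO := subset_trans IG GO.
by do ![split] => S1X; apply: nS1; apply: sub_S1 S1X.
Qed.
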